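(* Let $A:\operatorname{D}(A)\to\mathcal H$ be a self-adjoint operator on a Hilbert space $\mathcal H$ and let $\mathcal L\subset \operatorname{D}(A)$ be a finite-dimensional subspace. For all $t\in\mathbb R$ with $\mathcal L\cap\ker(A-t)=\{0\}$, $$t+\frac{1}{\tau_j^-(t)}\leq \mathfrak n_j^-(t)\quad\text{for all } j\in\{1,\dots,n^-(t)\},\qquad \mathfrak n_j^+(t)\leq t+\frac{1}{\tau_j^+(t)}\quad\text{for all } j\in\{1,\dots,n^+(t)\}.$$
   Context: Consider the problem of finding $u\in\mathcal L\setminus\{0\}$ and $\tau\in\mathbb R$ such that $\tau\langle (A-t)u,(A-t)v\rangle=\langle (A-t)u,v\rangle$ for all $v\in\mathcal L$. Its negative and positive eigenvalues, counted with multiplicity, are denoted $$\tau^-_1(t)\le\dots\le\tau^-_{n^-(t)}(t)<0\qquad\text{and}\qquad 0<\tau^+_{n^+(t)}(t)\le\dots\le\tau_1^+(t),$$ so $n^\mp(t)$ are the numbers of negative/positive eigenvalues. Let $\mathbb 1_I(A)$ be the spectral projector of $A$ associated with a Borel set $I\subset\mathbb R$, $\operatorname{Tr}\mathbb 1_I(A)=\dim\mathbb 1_I(A)\mathcal H$. Define $$\mathfrak n_j^-(t)=\sup\{s<t:\operatorname{Tr}\mathbb 1_{(s,t]}(A)\ge j\},\qquad \mathfrak n_j^+(t)=\inf\{s>t:\operatorname{Tr}\mathbb 1_{[t,s)}(A)\ge j\},$$ with $\mathfrak n_j^-(t)=-\infty$ if $\operatorname{Tr}\mathbb 1_{(-\infty,t]}(A)<j$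 and $\mathfrak n_j^+(t)=+\infty$ if $\operatorname{Tr}\mathbb 1_{[t,+\infty)}(A)<j$. Statements about bounds on $\mathfrak n_j^\mp(t)$ are regarded as void in the respective one of these two cases. *)

(* Defs.v *)
From HB Require Import structures.
From mathcomp Require Import all_boot all_order all_algebra.
From mathcomp Require Import complex.
From mathcomp Require Import all_classical all_reals all_analysis.

Set Implicit Arguments.
Unset Strict Implicit.
Unset Printing Implicit Defensive.

Import Order.TTheory GRing.Theory Num.Theory.
Import numFieldNormedType.Exports.

Local Open Scope classical_set_scope.
Local Open Scope complex_scope.
Local Open Scope ring_scope.

(* A complex Hilbert space is a complete normed space over R[i] whose norm is
   induced by an inner product, linear in its first argument and antilinear in
   the second one. *)
Definition hilbert_product (R : realType) (H : completeNormedModType R[i])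
    (dot : {dot H for (@Num.conj R[i])}) : Prop :=
  forall u : H, `|u| ^+ 2 = dot u u.

Definition lin_indep (K : pzRingType) (V : lmodType K) (n : nat)
    (e : 'I_n -> V) : Prop :=
  forall c : 'I_n -> K, \sum_(i < n) c i *: e i = 0 -> forall i, c i = 0.

(* Dimension of a linear subspace, +oo if it is infinite-dimensional. *)
Definition vdim (R : realType) (H : lmodType R[i]) (L : set H) : \bar R :=
  ereal_sup [set n%:R%:E | n in
    [set n : nat | exists e : 'I_n -> H, lin_indep e /\ forall i, L (e i)]].

Definition finite_dim_subspace (R : realType) (H : lmodType R[i])
    (L : set H) : Prop :=
  GRing.submod_closed (mem L) /\ (vdim L < +oo)%E.

(* A possibly unbounded operator; the values of op outside dom are irrelevant. *)
Record linop (R : realType) (H : lmodType R[i]) := LinOp {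
  dom : set H;
  op :> H -> H;
  dom_subspace : GRing.submod_closed (mem dom);
  op_linear : forall (a : R[i]) u v, dom u -> dom v ->
    op (a *: u + v) = a *: op u + op v }.

Section SelfAdjoint.
Context (R : realType) (H : completeNormedModType R[i]).
Variable dot : {dot H for (@Num.conj R[i])}.

(* The graph of the adjoint B of A: v is in D(B) and B v = w. *)
Definition adjoint_graph (A : linop H) (v w : H) : Prop :=
  forall u, dom A u -> dot (A u) v = dot u w.

Definition self_adjoint (A : linop H) : Prop :=
  dense (dom A) /\
  forall v w, adjoint_graph A v w <-> dom A v /\ w = A v.

(* Projection-valued measures on the Borel sets of R; the value on a
   non-measurable set is irrelevant. Countable additivity is that of the
   set functions I |-> <E(I)u, u> = |E(I)u|^2. *)
Record pvm := PVM {
  proj :> set (measurableTypeR R) -> {linear H -> H};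
  proj_idem : forall I, measurable I -> forall u, proj I (proj I u) = proj I u;
  proj_sym : forall I, measurable I ->
    forall u v, dot (proj I u) v = dot u (proj I v);
  proj0 : forall u, proj set0 u = 0;
  projT : forall u, proj setT u = u;
  projI : forall I J, measurable I -> measurable J ->
    forall u, proj (I `&` J) u = proj I (proj J u);
  proj_sigma_additive : forall u, semi_sigma_additive
    (fun I => (complex.Re (`|proj I u| ^+ 2))%:E) }.

Definition spectral_measure (E : pvm) (u : H)
    (I : set (measurableTypeR R)) : \bar R :=
  (complex.Re (`|E I u| ^+ 2))%:E.

Section SpectralMeasure.
Variables (E : pvm) (u : H).

Let spectral_measure0 : spectral_measure E u set0 = 0%E.
Proof. by rewrite /spectral_measure proj0 normr0 expr0n. Qed.

Let spectral_measure_ge0 I : (0 <= spectral_measure E u I)%E.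
Proof.
rewrite /spectral_measure lee_fin.
have : 0 <= `|E I u| ^+ 2 by rewrite exprn_ge0.
by case: (_ ^+ 2) => a b; rewrite lecE /= => /andP[].
Qed.

HB.instance Definition _ := isMeasure.Build _ _ _ (spectral_measure E u)
  spectral_measure0 spectral_measure_ge0 (@proj_sigma_additive E u).

End SpectralMeasure.

(* E is the spectral measure of A, that is A = \int x dE(x), so that the
   spectral projector 1_I(A) is E I. By polarization it is enough to specify
   the quadratic form of A. *)
Definition spectral_resolution (A : linop H) (E : pvm) : Prop :=
  dom A = [set u | (\int[spectral_measure E u]_x ((x : R) ^+ 2)%:E < +oo)%E] /\
  forall u, dom A u ->
    dot (A u) u = (\int[spectral_measure E u]_x (x : R))%R%:C.

Definition trace_proj (E : pvm) (I : set (measurableTypeR R)) : \bar R :=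
  vdim (range (E I)).

Definition n_minus (E : pvm) (t : R) (j : nat) : \bar R :=
  if (j%:R%:E <= trace_proj E `]-oo, t])%E then
    ereal_sup [set s%:E | s in
      [set s : R | s < t /\ (j%:R%:E <= trace_proj E `]s, t])%E]]
  else -oo%E.

Definition n_plus (E : pvm) (t : R) (j : nat) : \bar R :=
  if (j%:R%:E <= trace_proj E `[t, +oo[)%E then
    ereal_inf [set s%:E | s in
      [set s : R | t < s /\ (j%:R%:E <= trace_proj E `[t, s[)%E]]
  else +oo%E.

Definition shift_op (A : linop H) (t : R) (u : H) : H := A u - t%:C *: u.

Definition ker_shift (A : linop H) (t : R) : set H :=
  [set u | dom A u /\ shift_op A t u = 0].

Definition tau_eigenspace (A : linop H) (L : set H) (t tau : R) : set H :=
  [set u | L u /\ forall v, L v ->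
    tau%:C * dot (shift_op A t u) (shift_op A t v) = dot (shift_op A t u) v].

(* s lists, in the order r, the eigenvalues satisfying P, each of them
   repeated according to its multiplicity. Such a list is unique when r is
   antisymmetric. *)
Definition tau_enum (r : rel R) (P : pred R) (A : linop H) (L : set H) (t : R)
    (s : seq R) : Prop :=
  [/\ sorted r s, all P s & forall tau, P tau ->
    vdim (tau_eigenspace A L t tau) = (count_mem tau s)%:R%:E].

Definition tau_minus_enum (A : linop H) (L : set H) (t : R) (s : seq R) :=
  tau_enum (fun x y => x <= y) (fun x => x < 0) A L t s.

Definition tau_plus_enum (A : linop H) (L : set H) (t : R) (s : seq R) :=
  tau_enum (fun x y => y <= x) (fun x => 0 < x) A L t s.

End SelfAdjoint.

(* tau_1, ..., tau_n are indexed from 1. *)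
Definition tau_ (R : realType) (s : seq R) (j : nat) : R := nth 0 s j.-1.

(* Main.v *)
Require Import Defs.
From HB Require Import structures.
From mathcomp Require Import all_boot all_order all_algebra.
From mathcomp Require Import complex.
From mathcomp Require Import all_classical all_reals all_analysis.
From mathcomp Require Import measurable_realfun ring lra.
Import Order.TTheory GRing.Theory Num.Theory.
Import numFieldNormedType.Exports.
Local Open Scope classical_set_scope.
Local Open Scope ring_scope.

Set Implicit Arguments.
Unset Strict Implicit.
Unset Printing Implicit Defensive.

(** Write S = A - t, a = 1 / tau_j and mu_u(I) = |E(I) u|^2. Eigenvectors of the
    pencil tau <S u, S v> = <S u, v> for distinct eigenvalues are orthogonal
    with respect to <S u, S v>, which is positive definite on L because L meets
    ker (A - t) trivially. Hence the eigenvectors for tau_1, ..., tau_j are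
    linearly independent, and every u in the j-dimensional space V that they
    span satisfies |S u|^2 <= a <S u, u>: in both signs this only uses that
    tau_i / tau_j >= 1 for i <= j ([eigen_family]).

    By the spectral theorem that inequality reads
    \int (x - t) (x - (t + a)) dmu_u <= 0. Let I be an interval between t and a
    point slightly beyond t + a, chosen so that the integrand is positive off I.
    If E(I) u = 0, then mu_u is carried by the complement of I, so mu_u = 0 and
    u = 0 ([proj_shift_inj]). So E(I) is injective on V, its range has dimension
    at least j ([trace_proj_ge]), and the bounds follow by letting the endpoint
    of I tend to t + a.

    The spectral resolution only gives <A u, u> = \int x dmu_u, so the spectral
    form of |S u|^2 has to be derived. One inequality suffices,
    \int (x - t)^2 dmu_u <= |S u|^2 ([Rintegral_sqr_le]). It comes from testing
    S u against the vectors f(A) u, f a simple function with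
    f(x)^2 <= f(x) (x - t), by means of <S u, E(I) u> = \int_I (x - t) dmu_u
    ([rdot_shift_proj]). *)

(** * Linear independence *)

Lemma sum_fiber {V : nmodType} {T : eqType} n (s : seq T) (x : 'I_n -> T)
    (F : 'I_n -> V) : uniq s -> (forall i, x i \in s) ->
  \sum_i F i = \sum_(y <- s) \sum_(i | x i == y) F i.
Proof.
move=> us xs; rewrite (exchange_big_dep predT)//=; apply: eq_bigr => i _.
rewrite big_mkcond (bigD1_seq (x i))//= eqxx big1 ?addr0// => y.
by rewrite eq_sym => /negbTE ->.
Qed.

(** Reindexing through [P] and [g] serves both to restrict an independent
    family and to extract the vectors of a single eigenspace. *)
Lemma lin_indep_inj {K : pzRingType} {V : lmodType K} n (e : 'I_n -> V)
    {J : finType} (P : pred J) (g : J -> 'I_n) (c : J -> K) :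
  lin_indep e -> {in P &, injective g} ->
  \sum_(j | P j) c j *: e (g j) = 0 -> forall j, P j -> c j = 0.
Proof.
move=> inde injg ce0 j Pj.
have /inde/(_ (g j)) : \sum_k (\sum_(i | P i && (g i == k)) c i) *: e k = 0.
  rewrite -[RHS]ce0 (partition_big g predT)//=; apply: eq_bigr => k _.
  by rewrite scaler_suml; apply: eq_bigr => i /andP[_ /eqP ->].
rewrite (big_pred1 j)// => i /=; apply/andP/eqP => [[Pi /eqP]|->]; last first.
  by split.
exact: injg.
Qed.

Lemma vdim_ge {R : realType} {V : lmodType (complex R)} (M : set V) n
    (e : 'I_n -> V) : lin_indep e -> (forall i, M (e i)) ->
  (n%:R%:E <= vdim M)%E.
Proof.
by move=> inde Me; apply: ereal_sup_ubound; exists n => //; exists e.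
Qed.

Lemma vdim_lin_indep {R : realType} {V : lmodType (complex R)} (M : set V) n :
  ((0 < n)%N -> (n%:R%:E <= vdim M)%E) ->
  exists e : nat -> V, lin_indep (fun i : 'I_n => e i) /\
    forall i, (i < n)%N -> M (e i).
Proof.
case: n => [|n] hn; first by exists (fun=> 0); split=> // c _ [].
have : (n%:R%:E < vdim M)%E.
  by apply: lt_le_trans (hn _) => //; rewrite lte_fin ltr_nat.
move=> /ereal_sup_gt[_ [N [e [inde Me]] <-]]; rewrite lte_fin ltr_nat => nN.
pose f i := oapp e 0 (insub i).
have fE i (iN : (i < N)%N) : f i = e (Ordinal iN) by rewrite /f insubT.
exists f; split => [c c0 i|i iN]; last by rewrite (fE i (leq_trans iN nN)).
apply: (@lin_indep_inj _ _ _ e _ predT (widen_ord nN) c) => //.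
  by move=> x y _ _ /(congr1 val)/= xy; exact: val_inj.
rewrite -[RHS]c0; apply: eq_bigr => k _.
rewrite (fE k (leq_trans (ltn_ord k) nN)).
by congr (_ *: e _); exact: val_inj.
Qed.

(** The number of earlier occurrences of an entry tells apart the repetitions of
    an eigenvalue in a list with multiplicities. *)
Lemma ltn_count_take {T : eqType} (x0 : T) (s : seq T) i j :
  (i < j <= size s)%N ->
  (count_mem (nth x0 s i) (take i s) < count_mem (nth x0 s i) (take j s))%N.
Proof.
move=> /andP[ij js].
rewrite -(cat_take_drop i (take j s)) take_takel ?(ltnW ij)// count_cat.
rewrite (drop_nth x0) ?size_takel// nth_take//= eqxx.
by rewrite addnCA add1n ltnS leq_addr.
Qed.

(** * The real inner product *)

Section RealInnerProduct.
Context {R : realType} {H : completeNormedModType (complex R)}.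
Variable dot : {dot H for (@Num.conj (complex R))}.

(** The real part suffices for norms and for all the inequalities below, and it
    is a symmetric real bilinear form. *)
Definition rdot (u v : H) : R := complex.Re (dot u v).

Lemma rdotC u v : rdot u v = rdot v u.
Proof.
have ReC (z : complex R) : complex.Re (Num.conj z) = complex.Re z by case: z.
by rewrite /rdot (hermC dot u v) expr0 mul1r; exact: ReC.
Qed.

Lemma rdotDl u v w : rdot (u + v) w = rdot u w + rdot v w.
Proof. by rewrite /rdot linearDl raddfD. Qed.

Lemma rdotDr u v w : rdot u (v + w) = rdot u v + rdot u w.
Proof. by rewrite rdotC rdotDl !(rdotC u). Qed.

Lemma rdotNl u v : rdot (- u) v = - rdot u v.
Proof. by rewrite /rdot linearNl raddfN. Qed.

Lemma rdotNr u v : rdot u (- v) = - rdot u v.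
Proof. by rewrite rdotC rdotNl (rdotC u). Qed.

Lemma rdotBl u v w : rdot (u - v) w = rdot u w - rdot v w.
Proof. by rewrite rdotDl rdotNl. Qed.

Lemma rdotBr u v w : rdot u (v - w) = rdot u v - rdot u w.
Proof. by rewrite rdotDr rdotNr. Qed.

Lemma Re_realM (a : R) (z : complex R) :
  complex.Re (a%:C%C * z) = a * complex.Re z.
Proof. by case: z => x y; rewrite /= mul0r subr0. Qed.

Lemma rdotZl (a : R) u v : rdot (a%:C%C *: u) v = a * rdot u v.
Proof. by rewrite /rdot linearZl_LR /= Re_realM. Qed.

Lemma rdotZr (a : R) u v : rdot u (a%:C%C *: v) = a * rdot u v.
Proof. by rewrite rdotC rdotZl (rdotC u). Qed.

Lemma rdot0l u : rdot 0 u = 0.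
Proof. by rewrite /rdot linear0l. Qed.

Lemma rdot0r u : rdot u 0 = 0.
Proof. by rewrite rdotC rdot0l. Qed.

Lemma rdot_suml (I : Type) (r : seq I) (P : pred I) (F : I -> H) v :
  rdot (\sum_(i <- r | P i) F i) v = \sum_(i <- r | P i) rdot (F i) v.
Proof.
elim/big_rec2: _ => [|i x y _ <-]; first by rewrite rdot0l.
by rewrite rdotDl.
Qed.

Lemma rdot_sumr (I : Type) (r : seq I) (P : pred I) (F : I -> H) v :
  rdot v (\sum_(i <- r | P i) F i) = \sum_(i <- r | P i) rdot v (F i).
Proof. by rewrite rdotC rdot_suml; apply: eq_bigr => i _; rewrite rdotC. Qed.

Hypothesis hdot : hilbert_product dot.

Lemma rdot_norm u : complex.Re (`|u| ^+ 2) = rdot u u.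
Proof. by rewrite hdot. Qed.

Lemma rdot_ge0 u : 0 <= rdot u u.
Proof.
rewrite -rdot_norm; have : 0 <= `|u| ^+ 2 by rewrite exprn_ge0.
by case: (_ ^+ 2) => a b; rewrite lecE /= => /andP[].
Qed.

Lemma rdot_eq0 u : rdot u u = 0 -> u = 0.
Proof.
rewrite -rdot_norm => h; apply/eqP; rewrite -normr_eq0 -sqrf_eq0.
have : 0 <= `|u| ^+ 2 by rewrite exprn_ge0.
move: h; case: (_ ^+ 2) => a b /= ->.
by rewrite lecE /= => /andP[/eqP -> _].
Qed.

(** With w the sum of the [v i], this is |g - w|^2 >= 0 combined with
    |w|^2 <= <g, w>. *)
Lemma bessel (I : eqType) (s : seq I) (v : I -> H) (g : H) : uniq s ->
  (forall i j, i \in s -> j \in s -> i != j -> rdot (v i) (v j) = 0) ->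
  (forall i, i \in s -> rdot (v i) (v i) <= rdot g (v i)) ->
  \sum_(i <- s) rdot (v i) (v i) <= rdot g g.
Proof.
move=> us ortho le_g; set w := \sum_(i <- s) v i.
have wE : rdot w w = \sum_(i <- s) rdot (v i) (v i).
  rewrite rdot_suml; apply: eq_big_seq => i si.
  rewrite rdot_sumr (bigD1_seq i)//= big1_seq ?addr0// => j /andP[ji sj].
  by rewrite ortho// eq_sym.
have : 0 <= rdot (g - w) (g - w) by exact: rdot_ge0.
rewrite rdotBl !rdotBr (rdotC w g) wE rdot_sumr.
have : \sum_(i <- s) rdot (v i) (v i) <= \sum_(i <- s) rdot g (v i).
  by rewrite big_seq [leRHS]big_seq; exact: ler_sum.
lra.
Qed.

End RealInnerProduct.

(** * Spectral measures and quadratic forms *)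

Section Spectral.
Context {R : realType} {H : completeNormedModType (complex R)}.
Variable dot : {dot H for (@Num.conj (complex R))}.
Hypothesis hdot : hilbert_product dot.
Variable E : pvm dot.

Local Notation rdot := (rdot dot).
Local Notation mu := (spectral_measure E).

Lemma rdot_proj I u v : measurable I -> rdot (E I u) v = rdot u (E I v).
Proof. by move=> mI; rewrite /rdot proj_sym. Qed.

Lemma rdot_projI I J u : measurable I -> measurable J ->
  rdot (E I u) (E J u) = rdot u (E (I `&` J) u).
Proof. by move=> mI mJ; rewrite rdot_proj// projI. Qed.

Lemma spectral_measureE u I : measurable I ->
  mu u I = (rdot u (E I u))%:E.
Proof.
by move=> mI; rewrite /spectral_measure (rdot_norm hdot) rdot_projI// setIid.
Qed.

Lemma spectral_measure_proj u I J : measurable I -> measurable J ->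
  mu (E I u) J = mu u (J `&` I).
Proof. by move=> mI mJ; rewrite /spectral_measure projI. Qed.

Let spectral_measure_fin u : fin_num_fun (mu u).
Proof. by []. Qed.

HB.instance Definition _ u :=
  Measure_isFinite.Build _ _ _ (mu u) (spectral_measure_fin u).

(** Finite additivity is only known for the scalar measures: the vector
    w = u - E(I) u - E(~I) u is killed by both projections, so that
    |w|^2 = mu_w(I) + mu_w(~I) = 0. *)
Lemma proj_setC I u : measurable I -> u = E I u + E (~` I) u.
Proof.
move=> mI; have mC := measurableC mI.
apply/eqP; rewrite -subr_eq0; apply/eqP/(rdot_eq0 hdot).
set w := _ - _.
have Ew J : measurable J -> E J w = E J u - (E (J `&` I) u + E (J `&` ~` I) u).
  by move=> mJ; rewrite raddfB raddfD /= !projI.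
have : mu w setT = (mu w I + mu w (~` I))%E.
  by rewrite -measureU ?setICr// setUv.
rewrite !spectral_measureE// Ew// Ew// Ew//.
rewrite setICr setICl !setIid !proj0 !setTI projT addr0 add0r !subrr.
by rewrite !rdot0r adde0 -/w => -[].
Qed.

(** The measure of E(I) u vanishes off I and agrees with that of u inside I. *)
Lemma Rintegral_proj u I (f : R -> R) : measurable I ->
  (mu (E I u)).-integrable setT (EFin \o f) ->
  (\int[mu (E I u)]_x f x = \int[mu u]_(x in I) f x)%R.
Proof.
move=> mI intf; congr fine; have mC := measurableC mI.
rewrite (negligible_integral mC)//; last first.
  by rewrite [LHS]spectral_measure_proj// setICl measure0.
rewrite setTD setCK; apply: eq_measure_integral => J mJ JI.
by rewrite [LHS]spectral_measure_proj//; congr (mu u _); apply/setIidl.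
Qed.

Variable A : linop H.
Hypothesis hE : spectral_resolution A E.
Hypothesis hA : self_adjoint dot A.

Lemma integrable_sqr u : dom A u ->
  (mu u).-integrable setT (fun x : R => (x ^+ 2)%:E).
Proof.
case: hE => -> _ /= h; apply/integrableP; split.
  exact/measurable_EFinP/measurable_funX.
apply: le_lt_trans h; rewrite le_eqVlt; apply/orP; left; apply/eqP.
by apply: eq_integral => x _ /=; rewrite ger0_norm// sqr_ge0.
Qed.

Lemma spectral_integrable_cst u (I : set (measurableTypeR R)) (c : R) :
  measurable I ->
  (mu u).-integrable I (EFin \o cst c).
Proof. exact: finite_measure_integrable_cst. Qed.

(** The measure is finite and |x| <= x^2 + 1. *)
Lemma integrable_id u : dom A u -> (mu u).-integrable setT (fun x : R => x%:E).
Proof.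
move=> du; have i1 := spectral_integrable_cst u 1 measurableT.
have := integrableD measurableT (integrable_sqr du) i1.
apply: le_integrable => //; first exact/measurable_EFinP.
move=> x _; rewrite lee_fin [leRHS]ger0_norm; last first.
  by rewrite addr_ge0// sqr_ge0.
have h1 : 0 <= (x - 1) ^+ 2 by exact: sqr_ge0.
have h2 : 0 <= (x + 1) ^+ 2 by exact: sqr_ge0.
by case: (ger0P x) => hx /=; nra.
Qed.

Lemma dom_proj u I : measurable I -> dom A u -> dom A (E I u).
Proof.
move=> mI; case: hE => -> _ /=; apply: le_lt_trans.
apply: ge0_le_measure_integral => //.
- move=> J mJ; rewrite [leLHS]spectral_measure_proj//.
  by apply: le_measure; rewrite ?inE//; exact: measurableI.
- by move=> x; rewrite lee_fin sqr_ge0.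
- exact/measurable_EFinP/measurable_funX.
Qed.

Lemma opD u v : dom A u -> dom A v -> A (u + v) = A u + A v.
Proof. by move=> du dv; have := op_linear 1 du dv; rewrite !scale1r. Qed.

Lemma op_sym u v : dom A u -> dom A v -> dot (A u) v = dot u (A v).
Proof.
by move=> du dv; have [_ /(_ v (A v))[_ /(_ (conj dv erefl))]] := hA; exact.
Qed.

Lemma rdot_op u : dom A u -> rdot (A u) u = \int[mu u]_x (x : R).
Proof. by case: hE => _ h du; rewrite /rdot h. Qed.

(** Put w = E(I) u and z = E(~I) u. The quadratic form of A is additive on the
    splitting u = w + z, as both sides are integrals over complementary sets.
    Hence <A w, z> + <A z, w> has zero real part; as A is symmetric the two real
    parts agree, so each vanishes. *)
Lemma rdot_op_proj u I : measurable I -> dom A u ->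
  rdot (A u) (E I u) = \int[mu u]_(x in I) (x : R).
Proof.
move=> mI du; have mC := measurableC mI.
have dI := dom_proj mI du; have dC := dom_proj mC du.
have intu := integrable_id du.
have q J : measurable J ->
    rdot (A (E J u)) (E J u) = \int[mu u]_(x in J) (x : R).
  move=> mJ; have dJ := dom_proj mJ du.
  by rewrite rdot_op// Rintegral_proj//; exact: integrable_id.
have AE : A u = A (E I u) + A (E (~` I) u) by rewrite -opD// -proj_setC.
have sym : rdot (A (E (~` I) u)) (E I u) = rdot (A (E I u)) (E (~` I) u).
  by rewrite rdotC /rdot -op_sym.
have : rdot (A u) u =
    rdot (A (E I u)) (E I u) + rdot (A (E (~` I) u)) (E (~` I) u).
  rewrite !q// rdot_op// -Rintegral_setU//; first by rewrite setUv.
  - by rewrite setUv.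
  - by apply/disj_setPS; rewrite setICr.
rewrite {2}(proj_setC u mI) AE !rdotDl !rdotDr sym -q// => h.
by lra.
Qed.

Variable t : R.
Local Notation S := (shift_op A t).

Let integrable_sub u : dom A u ->
  (mu u).-integrable setT (fun x : R => (x - t)%:E).
Proof.
move=> du; exact: (integrableB measurableT (integrable_id du)
  (spectral_integrable_cst u t measurableT)).
Qed.

Let integrable_subS u I : measurable I -> dom A u ->
  (mu u).-integrable I (fun x : R => (x - t)%:E).
Proof.
by move=> mI du; apply: integrableS (integrable_sub du).
Qed.

Let integrable_sub_sqr u : dom A u ->
  (mu u).-integrable setT (fun x : R => ((x - t) ^+ 2)%:E).
Proof.
move=> du.
have := integrableD measurableT (integrable_sqr du)
  (integrableB measurableT
     (spectral_integrable_cst u (t ^+ 2) measurableT)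
     (integrableZl measurableT (2 * t) (integrable_id du))).
apply: eq_integrable => // x _ /=; congr EFin; ring.
Qed.

Lemma Rintegral_cst_proj u I c : measurable I ->
  \int[mu u]_(x in I) c = c * rdot u (E I u).
Proof.
by move=> mI; rewrite Rintegral_cst// [X in fine X]spectral_measureE.
Qed.

Lemma rdot_shift_proj u I : measurable I -> dom A u ->
  rdot (S u) (E I u) = \int[mu u]_(x in I) (x - t).
Proof.
move=> mI du; rewrite /shift_op rdotBl rdotZl rdot_op_proj//.
rewrite -Rintegral_cst_proj// RintegralB//.
- by apply: integrableS (integrable_id du).
- exact: spectral_integrable_cst.
Qed.

(** Here v = r sgn(x - t) 1_D(A) u. The sign makes <S u, v> equal to
    r \int_D |x - t| dmu_u, which dominates r^2 mu_u(D) = |v|^2. *)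
Lemma le_rdot_shift u D (r : R) : dom A u -> measurable D -> 0 <= r ->
  (forall x : R, D x -> r <= `|x - t|) ->
  let v := r%:C%C *: (E (D `&` `[t, +oo[) u - E (D `\` `[t, +oo[) u) in
  rdot v v = r ^+ 2 * rdot u (E D u) /\ rdot v v <= rdot (S u) v.
Proof.
move=> du mD r0 rD v.
have mP : measurable (`[t, +oo[%classic : set (measurableTypeR R)).
  exact: measurable_itv.
set D1 := D `&` _ in v *; set D2 := D `\` _ in v *.
have mD1 : measurable D1 by exact: measurableI.
have mD2 : measurable D2 by exact: measurableD.
have D12 : D1 `&` D2 = set0 by rewrite /D1 /D2 setDE setIACA setICr setI0.
have ED : E D u = E D1 u + E D2 u.
  rewrite /D1 /D2 setDE !projI//; last exact: measurableC.
  by rewrite -raddfD -proj_setC.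
have vv : rdot v v = r ^+ 2 * rdot u (E D u).
  rewrite /v rdotZl rdotZr rdotBl !rdotBr !rdot_projI// (setIC D2) D12 !setIid.
  by rewrite proj0 rdot0r ED rdotDr expr2; ring.
split => //; rewrite vv /v rdotZr rdotBr !rdot_shift_proj// ED rdotDr.
rewrite expr2 -mulrA ler_wpM2l// mulrDr lerD//.
- rewrite -Rintegral_cst_proj//; apply: le_Rintegral => //.
  + exact: spectral_integrable_cst.
  + exact: integrable_subS.
  + move=> x [Dx]; rewrite /= in_itv/= andbT => tx.
    by rewrite (le_trans (rD x Dx))// ger0_norm// subr_ge0.
- rewrite lerNr -mulNr -Rintegral_cst_proj//; apply: le_Rintegral => //.
  + exact: integrable_subS.
  + exact: spectral_integrable_cst.
  + move=> x [Dx]; rewrite /= in_itv/= andbT => /negP; rewrite -ltNge => xt.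
    by rewrite lerNr (le_trans (rD x Dx))// ltr0_norm// subr_lt0.
Qed.

Import HBNNSimple.

(** The integral is the supremum of those of the simple functions
    0 <= h <= (x - t)^2. On the level set h = r the vector
    sqrt r sgn(x - t) 1_(h = r)(A) u has squared norm r mu_u(h = r); these
    vectors are orthogonal for distinct r, and Bessel's inequality applies to
    S u. *)
Lemma Rintegral_sqr_le u : dom A u ->
  \int[mu u]_x (x - t) ^+ 2 <= rdot (S u) (S u).
Proof.
move=> du; rewrite -lee_fin fineK; last first.
  exact: (integrable_fin_num measurableT (integrable_sub_sqr du)).
rewrite ge0_integralTE; last by move=> x; rewrite lee_fin sqr_ge0.
apply: ge_ereal_sup => _ [h/= hle <-].
rewrite sintegralE fsbig_finite//=.
pose s := finmap.enum_fset (fset_set (range h)).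
pose D (r : R) : set (measurableTypeR R) := h @^-1` [set r].
have mD r : measurable (D r) by exact: measurable_funPTI.
have s_ge0 r : r \in s -> 0 <= r.
  have -> : (r \in s) = (r \in range h) by exact: in_fset_set.
  by rewrite inE => -[x _ <-]; exact: fun_ge0.
pose v r : H := (Num.sqrt r)%:C%C *:
  (E (D r `&` `[t, +oo[) u - E (D r `\` `[t, +oo[) u).
have vP r : r \in s -> rdot (v r) (v r) = r * rdot u (E (D r) u) /\
    rdot (v r) (v r) <= rdot (S u) (v r).
  move=> rs; have rD (x : R) : D r x -> Num.sqrt r <= `|x - t|.
    by move=> <-; rewrite -sqrtr_sqr ler_wsqrtr//; exact: hle.
  have := le_rdot_shift du (mD r) (sqrtr_ge0 r) rD.
  by rewrite sqr_sqrtr ?s_ge0.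
rewrite [leLHS](_ : _ = (\sum_(r <- s) rdot (v r) (v r))%:E); last first.
  rewrite -sumEFin; apply: eq_big_seq => r rs; have [-> _] := vP r rs.
  by rewrite spectral_measureE// EFinM.
rewrite lee_fin; apply: (bessel hdot).
- exact: finmap.fset_uniq.
- move=> r r' rs r's rr'.
  have D0 : D r `&` D r' = set0.
    apply/seteqP; split=> // x [xr xr'].
    by case/eqP: rr'; exact: etrans (esym xr) xr'.
  pose w := E `[t, +oo[%classic u - E (~` `[t, +oo[%classic) u.
  have mP : measurable (`[t, +oo[%classic : set (measurableTypeR R)).
    exact: measurable_itv.
  have vE q : v q = (Num.sqrt q)%:C%C *: E (D q) w.
    by rewrite /v /w setDE !projI//; [rewrite -raddfB|exact: measurableC].
  by rewrite !vE rdotZl rdotZr rdot_projI// D0 proj0 rdot0r !mulr0.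
- by move=> r rs; have [] := vP r rs.
Qed.

(** The integral of f(x) = (x - t) (x - (t + a)) against mu_u is at most
    |S u|^2 - a <S u, u> <= 0, while f > 0 on the complement of I, which carries
    mu_u. So mu_u vanishes. *)
Lemma proj_shift_inj (a : R) I u : measurable I -> dom A u ->
  (forall x : R, ~ I x -> 0 < (x - t) * (x - (t + a))) ->
  rdot (S u) (S u) <= a * rdot (S u) u -> E I u = 0 -> u = 0.
Proof.
move=> mI du fpos le_a Eu0; have mC := measurableC mI.
pose f (x : R) := (x - t) * (x - (t + a)).
have fE x : f x = (x - t) ^+ 2 - a * (x - t) by rewrite /f; ring.
have intZ : (mu u).-integrable setT (fun x : R => (a * (x - t))%:E).
  exact: integrableZl (integrable_sub du).
have intf : (mu u).-integrable setT (fun x : R => (f x)%:E).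
  apply: eq_integrable (integrableB _ (integrable_sub_sqr du) intZ) => //.
  by move=> x _ /=; rewrite fE.
have f_le0 : \int[mu u]_x f x <= 0.
  under eq_Rintegral do rewrite fE.
  rewrite RintegralB// ?RintegralZl//; try exact: integrable_sub_sqr.
    rewrite subr_le0 -rdot_shift_proj// projT.
    exact: le_trans (Rintegral_sqr_le du) le_a.
  exact: integrable_sub.
have muI : mu u I = 0%E by rewrite spectral_measureE// Eu0 rdot0r.
have intC : (\int[mu u]_(x in ~` I) `|(f x)%:E|)%E = 0%E.
  transitivity (\int[mu u]_(x in ~` I) (f x)%:E)%E.
    apply: eq_integral => x /[!inE] nIx; rewrite abse_EFin gtr0_norm//.
    exact: fpos.
  apply/eqP; rewrite eq_le; apply/andP; split; last first.
    by apply: integral_ge0 => x nIx; rewrite lee_fin ltW//; exact: fpos.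
  rewrite -setTD -negligible_integral//.
  by rewrite -(fineK (integrable_fin_num _ intf))//.
have muC : mu u (~` I) = 0%E.
  apply: measure_negligible => //.
  have mf : measurable_fun (~` I) (fun x : R => (f x)%:E).
    exact: measurable_funTS (measurable_int _ intf).
  have [/(_ intC) ae0 _] := ae_eq_integral_abs (mu u) mC mf.
  apply: negligibleS ae0 => x nIx /= /(_ nIx) [] f0.
  by have := fpos x nIx; rewrite -/(f x) f0 ltxx.
apply: (rdot_eq0 hdot).
have := spectral_measureE u mI; have := spectral_measureE u mC.
rewrite muI muC => -[h1] [h2].
by rewrite {2}(proj_setC u mI) rdotDr -h1 -h2 addr0.
Qed.

End Spectral.

(** * Eigenvectors of the pencil *)

Section Pencil.
Context {R : realType} {H : completeNormedModType (complex R)}.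
Variable dot : {dot H for (@Num.conj (complex R))}.
Hypothesis hdot : hilbert_product dot.
Variable A : linop H.
Hypothesis hA : self_adjoint dot A.
Variable L : set H.
Hypothesis subL : GRing.submod_closed (mem L).
Hypothesis hLA : L `<=` dom A.
Variable t : R.
Hypothesis ht : L `&` ker_shift A t = [set 0].

Local Notation rdot := (rdot dot).
Local Notation S := (shift_op A t).
Local Notation W := (tau_eigenspace dot A L t).

Lemma memL0 : L 0.
Proof. by have [] := subL; rewrite inE. Qed.

Lemma memLP a u v : L u -> L v -> L (a *: u + v).
Proof. by move=> Lu Lv; have [_ /(_ a u v)] := subL; rewrite !inE; exact. Qed.

Lemma shiftP a u v : L u -> L v -> S (a *: u + v) = a *: S u + S v.
Proof.
move=> /hLA du /hLA dv; rewrite /shift_op op_linear// scalerDr opprD.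
by rewrite scalerBr !scalerA (mulrC a) addrACA.
Qed.

Lemma shift0 : S 0 = 0.
Proof.
by have := shiftP (- 1) memL0 memL0; rewrite !scaleN1r oppr0 addr0 addNr.
Qed.

Lemma shift_sym u v : L u -> L v -> rdot (S u) v = rdot (S v) u.
Proof.
move=> /hLA du /hLA dv; rewrite /shift_op !rdotBl !rdotZl (rdotC dot v u).
by congr (_ - _); rewrite [RHS]rdotC /rdot (op_sym hA).
Qed.

Lemma shift_eq0 u : L u -> rdot (S u) (S u) = 0 -> u = 0.
Proof.
move=> Lu /(rdot_eq0 hdot) Su0.
have : (L `&` ker_shift A t) u by split=> //; split=> //; exact: hLA.
by rewrite ht.
Qed.

Lemma eigen_sub tau u : W tau u -> L u.
Proof. by case. Qed.

Lemma eigen0 tau : W tau 0.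
Proof.
by split; [exact: memL0|move=> v _; rewrite shift0 !linear0l mulr0].
Qed.

Lemma eigenP tau a u v : W tau u -> W tau v -> W tau (a *: u + v).
Proof.
move=> [Lu Wu] [Lv Wv]; split; first exact: memLP.
move=> z Lz; rewrite shiftP// !linearPl /= mulrDr mulrCA.
by rewrite Wu// Wv.
Qed.

Lemma eigen_lincomb tau (I : Type) (r : seq I) (P : pred I) (c : I -> complex R)
    (e : I -> H) : (forall i, P i -> W tau (e i)) ->
  W tau (\sum_(i <- r | P i) c i *: e i).
Proof.
move=> We; elim/big_rec: _ => [|i x Pi Wx]; first exact: eigen0.
by apply: eigenP => //; exact: We.
Qed.

Lemma rdot_eigen tau u v : W tau u -> L v ->
  rdot (S u) v = tau * rdot (S u) (S v).
Proof. by move=> [_ Wu] Lv; rewrite /rdot -Wu// Re_realM. Qed.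

(** Symmetry of <S u, v> gives tau <S u, S v> = tau' <S u, S v>. *)
Lemma eigen_ortho tau tau' u v : tau != tau' -> W tau u -> W tau' v ->
  rdot (S u) (S v) = 0.
Proof.
move=> neq Wu Wv; have Lu := eigen_sub Wu; have Lv := eigen_sub Wv.
have := shift_sym Lu Lv; rewrite (rdot_eigen Wu Lv) (rdot_eigen Wv Lu).
rewrite (rdotC dot (S v)) => /eqP; rewrite -subr_eq0 -mulrBl mulf_eq0 subr_eq0.
by rewrite (negbTE neq) => /eqP.
Qed.

Section EigenSum.
Variables (s : seq R) (w : R -> H).
Hypothesis us : uniq s.
Hypothesis Ww : forall tau, W tau (w tau).
Let u := \sum_(tau <- s) w tau.

Lemma mem_sum_eigen : L u.
Proof.
rewrite /u; elim/big_rec: _ => [|i x _ Lx]; first exact: memL0.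
by rewrite -[w i]scale1r; apply: memLP => //; exact: eigen_sub (Ww i).
Qed.

Lemma shift_sum_eigen : S u = \sum_(tau <- s) S (w tau).
Proof.
rewrite /u; suff [] : L (\sum_(tau <- s) w tau) /\
  S (\sum_(tau <- s) w tau) = \sum_(tau <- s) S (w tau) by [].
elim/big_rec2: _ => [|i y x _ [Lx <-]].
  by split; [exact: memL0|exact: shift0].
have Lw := eigen_sub (Ww i).
rewrite -[w i]scale1r shiftP// !scale1r; split=> //.
by rewrite -[w i]scale1r; exact: memLP.
Qed.

Lemma rdot_sum_eigenl tau : tau \in s ->
  rdot (S (w tau)) (S u) = rdot (S (w tau)) (S (w tau)).
Proof.
move=> ts; rewrite shift_sum_eigen rdot_sumr (bigD1_seq tau)//= big1 ?addr0//.
by move=> i ne; rewrite (eigen_ortho _ (Ww tau) (Ww i))// eq_sym.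
Qed.

(** Both sides are diagonal in the eigencomponents: they are the sums of
    |S w_tau|^2 and of a tau |S w_tau|^2. *)
Lemma rdot_shift_sum_eigen a : (forall tau, tau \in s -> 1 <= a * tau) ->
  rdot (S u) (S u) <= a * rdot (S u) u.
Proof.
move=> ha; rewrite {1 3}shift_sum_eigen !rdot_suml mulr_sumr.
rewrite big_seq [leRHS]big_seq; apply: ler_sum => tau ts.
rewrite (rdot_eigen (Ww tau) mem_sum_eigen) rdot_sum_eigenl// mulrA.
by rewrite ler_peMl ?ha// rdot_ge0.
Qed.

(** Pairing with S w_tau isolates |S w_tau|^2, which only vanishes for w_tau = 0
    since L meets ker (A - t) trivially. *)
Lemma sum_eigen_eq0 tau : tau \in s -> u = 0 -> w tau = 0.
Proof.
move=> ts u0; apply: (shift_eq0 (eigen_sub (Ww tau))).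
by rewrite -rdot_sum_eigenl// u0 shift0 rdot0r.
Qed.

End EigenSum.

(** Quantifying over [c] makes the inequality one on the whole span, as the
    counting argument needs. To get independent vectors for repeated entries of
    [s], the [i]-th vector is taken from a basis of its eigenspace, at
    the position given by the number of earlier occurrences of the same
    eigenvalue. *)
Lemma eigen_family (s : seq R) :
  (forall tau, tau \in s -> ((count_mem tau s)%:R%:E <= vdim (W tau))%E) ->
  exists e : 'I_(size s) -> H, lin_indep e /\
  forall c : 'I_(size s) -> complex R,
    let u := \sum_i c i *: e i in
    L u /\ forall a, (forall tau, tau \in s -> 1 <= a * tau) ->
      rdot (S u) (S u) <= a * rdot (S u) u.
Proof.
move=> hs.
have /choice[F FP] : forall tau, exists f : nat -> H,
    lin_indep (fun i : 'I_(count_mem tau s) => f i) /\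
    forall i, (i < count_mem tau s)%N -> W tau (f i).
  move=> tau; apply: vdim_lin_indep => c0; apply: hs.
  by rewrite -has_pred1 has_count.
pose x (i : 'I_(size s)) := nth 0 s i.
pose k (i : 'I_(size s)) := count_mem (x i) (take i s).
have klt i : (k i < count_mem (x i) s)%N.
  have := @ltn_count_take _ 0 s i (size s).
  by rewrite take_size ltn_ord leqnn; exact.
pose e i := F (x i) (k i).
have us := undup_uniq s.
have xs i : x i \in undup s by rewrite mem_undup mem_nth.
have We tau i : x i == tau -> W tau (e i).
  by move=> /eqP <-; have [_] := FP (x i); apply.
pose w c tau := \sum_(i | x i == tau) c i *: e i.
have Ww c tau : W tau (w c tau) by apply: eigen_lincomb; exact: We.
have sumE c : \sum_i c i *: e i = \sum_(tau <- undup s) w c tau.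
  exact: sum_fiber.
exists e; split => [c c0 i|c].
  have : w c (x i) = 0 by apply: (sum_eigen_eq0 us (Ww c)) => //; rewrite -sumE.
  have kin j : x j == x i -> (k j < count_mem (x i) s)%N by move=> /eqP <-.
  (* Within one fibre the rank k determines the position in s. *)
  pose g j := insubd (Ordinal (klt i)) (k j).
  have gE j : x j == x i -> g j = k j :> nat.
    by move=> /kin h; rewrite val_insubd h.
  have [indF _] := FP (x i) => wc.
  apply: (lin_indep_inj indF (P := fun j => x j == x i) (g := g)) => //.
    move=> j1 j2 x1 x2 /(congr1 val); rewrite /= !gE// => k12.
    apply/val_inj; case: (ltngtP j1 j2) => // j12;
      exfalso; move: k12; rewrite /k.
      rewrite (eqP x2) -(eqP x1) => /eqP; rewrite ltn_eqF// ltn_count_take//.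
      by rewrite j12 ltnW.
    rewrite (eqP x1) -(eqP x2) => /esym/eqP; rewrite ltn_eqF// ltn_count_take//.
    by rewrite j12 ltnW.
  rewrite -[RHS]wc; apply: eq_bigr => j xj.
  by rewrite gE// /e (eqP xj).
rewrite /= sumE; split; first exact: mem_sum_eigen.
move=> a ha; apply: rdot_shift_sum_eigen => // tau.
by rewrite mem_undup; exact: ha.
Qed.

Variable E : pvm dot.
Hypothesis hE : spectral_resolution A E.

(** E(I) is injective on the span of the eigenvectors, so it maps them to an
    independent family of its range. *)
Lemma trace_proj_ge (s : seq R) (a : R) (I : set (measurableTypeR R)) :
  (forall tau, tau \in s -> ((count_mem tau s)%:R%:E <= vdim (W tau))%E) ->
  (forall tau, tau \in s -> 1 <= a * tau) ->
  measurable I -> (forall x : R, ~ I x -> 0 < (x - t) * (x - (t + a))) ->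
  ((size s)%:R%:E <= trace_proj E I)%E.
Proof.
move=> hs ha mI Ipos; have [e [inde eP]] := eigen_family hs.
apply: (@vdim_ge _ _ _ _ (fun i => E I (e i))); last by move=> i; exists (e i).
move=> c c0; have Eu0 : E I (\sum_i c i *: e i) = 0.
  by rewrite -[RHS]c0 linear_sum; apply: eq_bigr => i _; rewrite linearZ.
apply: inde; have [Lu /(_ a ha) le_a] := eP c.
exact: (proj_shift_inj hdot hE hA mI (hLA Lu) Ipos le_a Eu0).
Qed.

End Pencil.

(** * The eigenvalue bounds *)

Lemma tau_enum_take {R : realType} {H : completeNormedModType (complex R)}
    (dot : {dot H for (@Num.conj (complex R))}) (r : rel R) (P : pred R)
    (A : linop H) (L : set H) (t : R) (s : seq R) j :
  tau_enum dot r P A L t s -> forall tau, tau \in take j s ->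
  ((count_mem tau (take j s))%:R%:E <= vdim (tau_eigenspace dot A L t tau))%E.
Proof.
move=> [_ /allP Ps sP] tau /mem_take/Ps Ptau; rewrite sP// lee_fin ler_nat.
by rewrite -{2}(cat_take_drop j s) count_cat leq_addr.
Qed.

Lemma sorted_take_tau {R : realType} (r : rel R) (s : seq R) j :
  reflexive r -> transitive r -> sorted r s -> (1 <= j <= size s)%N ->
  forall tau, tau \in take j s -> r tau (tau_ s j).
Proof.
move=> rr rt rs /andP[j0 js] tau taus.
have ij : (index tau (take j s) < j)%N.
  by move: taus; rewrite -index_mem size_takel.
rewrite -(nth_index 0 taus) nth_take// /tau_.
apply: (sorted_leq_nth rt rr) => //; rewrite ?inE.
- exact: leq_trans ij js.
- by rewrite prednK.
- by rewrite -ltnS prednK.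
Qed.

Theorem corollary10 (R : realType) (H : completeNormedModType (complex R))
    (dot : {dot H for (@Num.conj (complex R))})
    (hdot : hilbert_product dot)
    (A : linop H) (hA : self_adjoint dot A)
    (E : pvm dot) (hE : spectral_resolution A E)
    (L : set H) (hL : finite_dim_subspace L) (hLA : L `<=` dom A)
    (t : R) (ht : L `&` ker_shift A t = [set 0])
    (tau_minus tau_plus : seq R)
    (hminus : tau_minus_enum dot A L t tau_minus)
    (hplus : tau_plus_enum dot A L t tau_plus) :
  (forall j : nat, (1 <= j <= size tau_minus)%N ->
     (j%:R%:E <= trace_proj E `]-oo, t])%E ->
     ((t + 1 / tau_ tau_minus j)%:E <= n_minus E t j)%E) /\
  (forall j : nat, (1 <= j <= size tau_plus)%N ->
     (j%:R%:E <= trace_proj E `[t, +oo[)%E ->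
     (n_plus E t j <= (t + 1 / tau_ tau_plus j)%:E)%E).
Proof.
have [subL _] := hL.
split=> j jle htr.
- have [sm Pm _] := hminus.
  have tauj_lt0 : tau_ tau_minus j < 0.
    move/allP: Pm; apply; apply: mem_nth.
    by case/andP: jle => j0 js; rewrite prednK.
  pose a := 1 / tau_ tau_minus j; rewrite -/a.
  have a_lt0 : a < 0 by rewrite /a div1r invr_lt0.
  have ha tau : tau \in take j tau_minus -> 1 <= a * tau.
    move=> taus; rewrite /a mulrAC mul1r ler_ndivlMr// mul1r.
    by apply: (sorted_take_tau _ _ sm jle taus); [exact: lexx|exact: le_trans].
  (* The endpoint t + a itself is a root of the quadratic polynomial, hence
     the approximation by t + a - e. *)
  rewrite /n_minus htr; apply/lee_subgt0Pr => e e0.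
  apply: ereal_sup_ubound; exists (t + a - e) => //; split; first lra.
  have := trace_proj_ge hdot hA subL hLA ht hE (tau_enum_take hminus) ha.
  rewrite size_takel; last by case/andP: jle.
  apply; first exact: measurable_itv.
  move=> x; rewrite /= in_itv/= => /negP; rewrite negb_and -leNgt -ltNge.
  by case/orP => hx; nra.
- have [sm Pm _] := hplus.
  have tauj_gt0 : 0 < tau_ tau_plus j.
    move/allP: Pm; apply; apply: mem_nth.
    by case/andP: jle => j0 js; rewrite prednK.
  pose a := 1 / tau_ tau_plus j; rewrite -/a.
  have a_gt0 : 0 < a by rewrite /a div1r invr_gt0.
  have ha tau : tau \in take j tau_plus -> 1 <= a * tau.
    move=> taus; rewrite /a mulrAC mul1r ler_pdivlMr// mul1r.
    apply: (sorted_take_tau _ _ sm jle taus); first exact: lexx.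
    by move=> x y z yx zy; exact: le_trans zy yx.
  rewrite /n_plus htr; apply/lee_addgt0Pr => e e0.
  apply: ereal_inf_lbound; exists (t + a + e) => //; split; first lra.
  have := trace_proj_ge hdot hA subL hLA ht hE (tau_enum_take hplus) ha.
  rewrite size_takel; last by case/andP: jle.
  apply; first exact: measurable_itv.
  move=> x; rewrite /= in_itv/= => /negP; rewrite negb_and -leNgt -ltNge.
  by case/orP => hx; nra.
Qed.
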